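(* In the setting of the context (step-size case $a<b$, fixed $\boldsymbol\theta^*\in\Theta$), for all $\alpha_2>\alpha_1>0$ we have $$\mathbf V^{(1)}_{\boldsymbol\theta}(\alpha_2)<_L\mathbf V^{(1)}_{\boldsymbol\theta}(\alpha_1)<_L\mathbf V^{(1)}_{\boldsymbol\theta}(0).$$ Furthermore, $\mathbf V^{(1)}_{\boldsymbol\theta}(\alpha)$ decreases to zero at a rate of $O(1/\alpha^2)$.
   Context: **Base chain.** $\mathcal N$ is a finite set with $N=|\mathcal N|$ elements, identified with $\{1,\dots,N\}$. $\Sigma$ is the probability simplex in $\mathbb R^N$, $\mathrm{Int}(\Sigma)$ its (relative) interior. $\mathbf P=[P_{ij}]$ is the transition matrix of an ergodic Markov chain on $\mathcal N$ with stationary distribution $\boldsymbol\mu\in\mathrm{Int}(\Sigma)$, time-reversible: $\mu_iP_{ij}=\mu_jP_{ji}$ for all $i,j$. Its eigenvalues are ordered $-1<\lambda_1\le\cdots\le\lambda_{N-1}<\lambda_N=1$, with left eigenvectors $\mathbf u_i$ and right eigenvectors $\mathbf v_i$, $\mathbf u_N=\boldsymbol\mu$, $\mathbf v_N=\mathbf 1$ (all-ones vector), normalized so that $\mathbf u_i^T\mathbf v_i=1$, $\mathbf u_i^T\mathbf v_j=0$ for $i\ne j$, and $\mathbf u_i=\mathrm{diag}(\boldsymbol\mu)\mathbf v_i$. **Optimization data.** $H:\mathbb R^D\times\mathcal N\to\mathbb R^D$ is continuous at every $\boldsymbol\theta\in\mathbb R^D$ with $\|H(\boldsymbol\theta,i)\|\le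 L(1+\|\boldsymbol\theta\|)$ for some $L>0$ and all $\boldsymbol\theta,i$; $\mathbf h(\boldsymbol\theta)=\sum_{i\in\mathcal N}\mu_iH(\boldsymbol\theta,i)$, and $\nabla$ is the Jacobian in $\boldsymbol\theta$. For $\alpha\ge0$, the SA-SRRW algorithm is $$X_{n+1}\sim\mathbf K_{X_n,\cdot}[\mathbf x_n],\quad \mathbf x_{n+1}=\mathbf x_n+\gamma_{n+1}(\boldsymbol\delta_{X_{n+1}}-\mathbf x_n),\quad \boldsymbol\theta_{n+1}=\boldsymbol\theta_n+\beta_{n+1}H(\boldsymbol\theta_n,X_{n+1}),$$ with $K_{ij}[\mathbf x]=P_{ij}(x_j/\mu_j)^{-\alpha}/\sum_{k}P_{ik}(x_k/\mu_k)^{-\alpha}$ and $\boldsymbol\delta_j$ the $j$-th standard basis vector of $\mathbb R^N$; the step sizes are $\beta_n=(n+1)^{-b}$, $\gamma_n=(n+1)^{-a}$ with $1/2<a<b\le1$ (case (i)). The roots of $\mathbf h$ are disjoint (isolated points) and comprise the globally attracting set $\Theta=\{\boldsymbol\theta^*:\mathbf h(\boldsymbol\theta^* )=\mathbf 0,\ \nabla\mathbf h(\boldsymbol\theta^* )+\tfrac{\mathbf 1_{\{b=1\}}}{2}\mathbf I\text{ is Hurwitz}\}\neq\emptyset$ of the ODE $d\boldsymbol\theta(t)/dt=\mathbf h(\boldsymbol\theta(t))$. For any initial point $(\boldsymbol\theta_0,\mathbf x_0,X_0)\in\mathbb R^D\times\mathrm{Int}(\Sigma)\times\mathcal N$, $\{\boldsymbol\theta_n\}$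 (resp. $\{\mathbf x_n\}$) is almost surely contained within a compact subset of $\mathbb R^D$ (resp. $\mathrm{Int}(\Sigma)$). **The matrix.** Fix $\boldsymbol\theta^*\in\Theta$, condition on the event $\{\boldsymbol\theta_n\to\boldsymbol\theta^*\}$, and let $\mathbf H=[H(\boldsymbol\theta^*,1),\dots,H(\boldsymbol\theta^*,N)]^T\in\mathbb R^{N\times D}$. For $\alpha\ge0$, the asymptotic covariance matrix of $\beta_n^{-1/2}(\boldsymbol\theta_n-\boldsymbol\theta^* )$ in case (i) is $$\mathbf V^{(1)}_{\boldsymbol\theta}(\alpha)=\int_0^\infty e^{t\left(\nabla\mathbf h(\boldsymbol\theta^* )+\frac{\mathbf 1_{\{b=1\}}}{2}\mathbf I\right)}\,\mathbf U_{\boldsymbol\theta}(\alpha)\,e^{t\left(\nabla\mathbf h(\boldsymbol\theta^* )+\frac{\mathbf 1_{\{b=1\}}}{2}\mathbf I\right)^T}dt,$$ $$\mathbf U_{\boldsymbol\theta}(\alpha)=\sum_{i=1}^{N-1}\frac{1}{(\alpha(1+\lambda_i)+1)^2}\cdot\frac{1+\lambda_i}{1-\lambda_i}\,\mathbf H^T\mathbf u_i\mathbf u_i^T\mathbf H .$$ **Notation.** For symmetric matrices, $\mathbf M_1<_L\mathbf M_2$ means that $\mathbf M_2-\mathbf M_1$ is positive semi-definite and $\mathbf M_1\ne\mathbf M_2$. A matrix is Hurwitz if all its eigenvalues have strictly negative real parts.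
   Formalization: The strict chain is proved assuming H(θ*,i) ≠ 0 for some i; otherwise (e.g. H(θ,i) = −θ, θ* = 0) V(α) = 0 for every α and the strict order fails. Convergence to zero and the O(1/α²) rate need no such assumption. *)

(* Defs.v *)
From mathcomp Require Import all_boot all_order all_algebra.
From mathcomp Require Import all_classical all_reals all_analysis.
From mathcomp Require Import complex.

Set Implicit Arguments.
Unset Strict Implicit.
Unset Printing Implicit Defensive.

Import Order.TTheory GRing.Theory Num.Theory.
Import numFieldNormedType.Exports.

Local Open Scope classical_set_scope.
Local Open Scope ring_scope.

(* Conventions.  The N states are 'I_n.+1, the state numbered N being ord_max.
   Distributions, left eigenvectors and points theta of R^D (D = d.+1) are row
   vectors, right eigenvectors are column vectors; hence the transposes below
   fall on the other factor than in the column-vector convention. *)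

Section Matrices.
Context {R : realType}.

Definition psd m (M : 'M[R]_m) :=
  M^T = M /\ forall x : 'cV[R]_m, 0 <= (x^T *m M *m x) 0 0.

Definition loewner_lt m (M1 M2 : 'M[R]_m) := psd (M2 - M1) /\ M1 <> M2.

Definition hurwitz m (A : 'M[R]_m) :=
  forall z : R[i], eigenvalue (map_mx (real_complex R) A) z -> complex.Re z < 0.

Definition expmx m (A : 'M[R]_m.+1) : 'M[R]_m.+1 :=
  lim (series (fun k => (k`!%:R)^-1 *: A ^+ k) @ \oo).

End Matrices.

Section BaseChain.
Context {R : realType} {n : nat}.
Implicit Types (P : 'M[R]_n.+1) (mu : 'rV[R]_n.+1).

Definition simplex_int : set 'rV[R]_n.+1 :=
  [set x | (forall i, 0 < x 0 i) /\ \sum_i x 0 i = 1].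

Definition stochastic P :=
  (forall i j, 0 <= P i j) /\ (forall i, \sum_j P i j = 1).

Definition irreducible P := forall i j, exists k, 0 < (P ^+ k) i j.

(* the gcd of the possible return times to i is 1 *)
Definition aperiodic P := forall i g,
  (forall k, (0 < k)%N -> 0 < (P ^+ k) i i -> (g %| k)%N) -> g = 1%N.

Definition ergodic P := [/\ stochastic P, irreducible P & aperiodic P].

Definition reversible P mu := forall i j, mu 0 i * P i j = mu 0 j * P j i.

(* Biorthonormality makes both families bases, so that lam lists all the
   eigenvalues of P with multiplicity. *)
Record spectral_data P mu (lam : 'I_n.+1 -> R)
    (u : 'I_n.+1 -> 'rV[R]_n.+1) (v : 'I_n.+1 -> 'cV[R]_n.+1) : Prop := {
  spec_gt : -1 < lam ord0;
  spec_le : forall i j : 'I_n.+1, (i <= j)%N -> lam i <= lam j;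
  spec_lt1 : forall i, i != ord_max -> lam i < 1;
  spec_1 : lam ord_max = 1;
  spec_left : forall i, u i *m P = lam i *: u i;
  spec_right : forall i, P *m v i = lam i *: v i;
  spec_uN : u ord_max = mu;
  spec_vN : v ord_max = const_mx 1;
  spec_orth : forall i j, (u i *m v j) 0 0 = (i == j)%:R;
  spec_uv : forall i, (u i)^T = diag_mx mu *m v i
}.

End BaseChain.

Section Algorithm.
Context {R : realType} {n d : nat}.
Implicit Types (P : 'M[R]_n.+1) (mu x : 'rV[R]_n.+1) (theta : 'rV[R]_d.+1).
Implicit Types (H : 'rV[R]_d.+1 -> 'I_n.+1 -> 'rV[R]_d.+1).
Implicit Types (s : nat -> 'I_n.+1).

Definition step (c : R) (k : nat) : R := k.+1%:R `^ (- c).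

Definition srrw_kernel P mu (alpha : R) x (i j : 'I_n.+1) : R :=
  P i j * (x 0 j / mu 0 j) `^ (- alpha)
  / \sum_k P i k * (x 0 k / mu 0 k) `^ (- alpha).

(* x_k and theta_k are deterministic functions of the path s of the sampler *)
Fixpoint srrw_x (a : R) x0 s k : 'rV[R]_n.+1 :=
  if k is k'.+1 then
    let x := srrw_x a x0 s k' in
    x + step a k'.+1 *: (delta_mx 0 (s k'.+1) - x)
  else x0.

Fixpoint srrw_theta H (b : R) theta0 s k : 'rV[R]_d.+1 :=
  if k is k'.+1 then
    let theta := srrw_theta H b theta0 s k' in
    theta + step b k'.+1 *: H theta (s k'.+1)
  else theta0.

(* X_{k+1} ~ K_{X_k, .}[x_k] given the past, stated as the product rule for
   the probabilities of all finite paths *)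
Definition srrw_chain (disp : measure_display) (Omega : measurableType disp)
    (Pr : probability Omega R) P mu (a alpha : R) x0 (X0 : 'I_n.+1)
    (X : nat -> Omega -> 'I_n.+1) : Prop :=
  [/\ forall k i, measurable [set w | X k w = i],
      forall w, X 0%N w = X0 &
      forall s m,
        Pr [set w | forall k, (k <= m.+1)%N -> X k w = s k] =
        (Pr [set w | forall k, (k <= m)%N -> X k w = s k] *
         (srrw_kernel P mu alpha (srrw_x a x0 s m) (s m) (s m.+1))%:E)%E].

(* The compact sets may depend on the sample point. *)
Definition srrw_stable P mu H (a b : R) : Prop :=
  forall (alpha : R) theta0 x0 (X0 : 'I_n.+1), 0 <= alpha -> simplex_int x0 ->
  forall (disp : measure_display) (Omega : measurableType disp)
    (Pr : probability Omega R) (X : nat -> Omega -> 'I_n.+1),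
  srrw_chain Pr P mu a alpha x0 X0 X ->
  {ae Pr, forall w,
    (exists2 C : set 'rV[R]_d.+1, compact C &
       forall k, C (srrw_theta H b theta0 (X ^~ w) k)) /\
    (exists C : set 'rV[R]_n.+1, [/\ compact C, C `<=` simplex_int &
       forall k, C (srrw_x a x0 (X ^~ w) k)])}.

Definition mean_field mu H theta : 'rV[R]_d.+1 := \sum_i mu 0 i *: H theta i.

(* The library's 'J acts on row vectors: ('J f p) j i is the j-th partial
   derivative of f_i, the transpose of the usual Jacobian matrix. *)
Definition drift_mx mu H (b : R) theta : 'M[R]_d.+1 :=
  ('J (mean_field mu H) theta)^T + ((b == 1)%:R / 2)%:M.

Definition Theta_set mu H (b : R) : set 'rV[R]_d.+1 :=
  [set theta | [/\ mean_field mu H theta = 0,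
                   differentiable (mean_field mu H) theta &
                   hurwitz (drift_mx mu H b theta)]].

Definition globally_attracting (h : 'rV[R]_d.+1 -> 'rV[R]_d.+1)
    (S : set 'rV[R]_d.+1) : Prop :=
  forall phi : R -> 'rV[R]_d.+1,
    {within `[0, +oo[, continuous phi} ->
    (forall t : R, 0 < t -> is_derive t 1 phi (h (phi t))) ->
    forall e : R, 0 < e ->
      \forall t \near +oo, exists2 theta, S theta & `|phi t - theta| < e.

(* All norms on R^D being equivalent, the library's max norm serves in the
   growth bound. *)
Record optimization_data mu H (b : R) : Prop := {
  opt_cont : forall i, continuous (H ^~ i);
  opt_growth : exists2 L : R, 0 < L &
    forall theta i, `|H theta i| <= L * (1 + `|theta|);
  opt_isolated : forall theta, mean_field mu H theta = 0 ->
    isolated [set t | mean_field mu H t = 0] theta;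
  opt_roots : [set theta | mean_field mu H theta = 0] = Theta_set mu H b;
  opt_nonempty : Theta_set mu H b !=set0;
  opt_attracting : globally_attracting (mean_field mu H) (Theta_set mu H b)
}.

Definition H_mx H theta : 'M[R]_(n.+1, d.+1) := \matrix_(i, j) H theta i 0 j.

Definition U_theta H (lam : 'I_n.+1 -> R) (u : 'I_n.+1 -> 'rV[R]_n.+1)
    theta (alpha : R) : 'M[R]_d.+1 :=
  \sum_(i < n.+1 | i != ord_max)
    (((alpha * (1 + lam i) + 1) ^+ 2)^-1 * ((1 + lam i) / (1 - lam i))) *:
    ((H_mx H theta)^T *m (u i)^T *m u i *m H_mx H theta).

Definition V_theta mu H (b : R) (lam : 'I_n.+1 -> R)
    (u : 'I_n.+1 -> 'rV[R]_n.+1) theta (alpha : R) : 'M[R]_d.+1 :=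
  let A := drift_mx mu H b theta in
  \matrix_(i, j) \int[lebesgue_measure]_(t in `[0, +oo[)
    ((expmx (t *: A) *m U_theta H lam u theta alpha *m expmx (t *: A^T)) i j).

End Algorithm.

(* Main.v *)
(* Let A be the Jacobian of the mean field at theta*, plus I/2 if b = 1.  Then
   V(alpha) = L(U(alpha)), where L(U) is the integral over [0, +oo[ of
   e^{tA} U e^{tA^T}.  Since A is Hurwitz, the entries of e^{tA} decay
   exponentially, so L is a well defined linear operator, and it maps psd
   matrices to psd ones.  Writing h_i = u_i H, U(alpha) is the combination of
   the Gram matrices h_i^T h_i with coefficients that are strictly decreasing
   in alpha and O(1/alpha^2), since -1 < lambda_i < 1; this yields the order and
   the rate.  Strictness: u_N H is the mean field at theta*, which is 0, and the
   u_i form a basis, so H <> 0 forces h_k <> 0 for some k < N, and then the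
   quadratic form of L(U(alpha1) - U(alpha2)) at h_k^T is the integral of a
   nonnegative continuous function that is positive at t = 0.
   Decay: factor the characteristic polynomial over C as prod (X - z_k).  By
   Cayley-Hamilton B = prod (A - z_k) = 0; stripping the factors one at a time,
   (B e^{tA})' = z B e^{tA} + B (A - z) e^{tA} and Gronwall's inequality carry
   the decay of B (A - z) e^{tA} over to B e^{tA}, down to B = 1. *)

Require Import Defs.
From mathcomp Require Import all_boot all_order all_algebra.
From mathcomp Require Import all_classical all_reals all_analysis.
From mathcomp Require Import measurable_realfun complex ring lra.
Import Order.TTheory GRing.Theory Num.Theory.
Import numFieldNormedType.Exports.
Local Open Scope classical_set_scope.
Local Open Scope ring_scope.
Set Implicit Arguments.
Unset Strict Implicit.
Unset Printing Implicit Defensive.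

(** * Entries of e^{tA} as power series in t: convergence, derivative, value at 0, transpose *)

Section MatrixExponential.
Context {R : realType} {m : nat}.
Implicit Types (A B : 'M[R]_m.+1) (t : R).

Lemma cvg_mx (T : Type) (F : set_system T) (FF : Filter F) p q
    (f : T -> 'M[R]_(p, q)) (L : 'M[R]_(p, q)) :
  (forall i j, f x i j @[x --> F] --> L i j) -> f @ F --> L.
Proof.
move=> fL; apply/cvg_mx_entourageP => E entE.
have h i j : \forall x \near F, (L i j, f x i j) \in E.
  have /cvg_entourageP/(_ E entE) := fL i j.
  by rewrite near_simpl; apply: filterS => x xE; rewrite inE.
suff : \forall x \near F,
    forall ij : 'I_p * 'I_q, (L ij.1 ij.2, f x ij.1 ij.2) \in E.
  by rewrite near_simpl; apply: filterS => x hx i j; exact: hx (i, j).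
by apply: filter_forall => -[i j]; exact: h.
Qed.

Definition exp_term A k t : 'M[R]_m.+1 := (k`!%:R)^-1 *: (t *: A) ^+ k.

Lemma expr_mx_bound A : exists2 K : R, 0 <= K &
  forall k i j, `|(A ^+ k) i j| <= K ^+ k.
Proof.
(* The sum of all absolute entries dominates the absolute sum of every row, so each multiplication
   by [A] costs at most one more factor of it. *)
exists (\sum_i \sum_l `|A i l|).
  by apply: sumr_ge0 => i _; apply: sumr_ge0.
elim => [|k IHk] i j.
  by rewrite !expr0 mxE; case: eqP => _; rewrite ?normr1 // normr0 ler01.
rewrite !exprS -mulmxE mxE (le_trans (ler_norm_sum _ _ _))//.
apply: (@le_trans _ _ (\sum_l `|A i l| * (\sum_i \sum_l `|A i l|) ^+ k)).
  by apply: ler_sum => l _; rewrite normrM ler_wpM2l.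
rewrite -mulr_suml ler_wpM2r ?exprn_ge0//.
  by apply: sumr_ge0 => ? _; apply: sumr_ge0.
rewrite [leRHS](bigD1 i)//= lerDl.
by apply: sumr_ge0 => ? _; apply: sumr_ge0.
Qed.

(** Taylor coefficients in t of the entry (i, j) of B e^{tA}. The left factor [B] closes the family
    under differentiation, which turns [B] into [B *m A]. *)
Let coef B A i j k : R := (k`!%:R)^-1 * (B *m A ^+ k) i j.

(** Termwise domination by a multiple of the exponential series at K|t|, where K bounds the growth
    of the powers of [A]. *)
Lemma cvg_pseries_coef B A i j t : cvgn (pseries (coef B A i j) t).
Proof.
have [K K0 AK] := expr_mx_bound A.
apply: normed_cvg.
have C0 : 0 <= \sum_l `|B i l| by apply: sumr_ge0.
apply: (@series_le_cvg _ _ ((\sum_l `|B i l|) *: exp_coeff (K * `|t|))) => //.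
- by move=> k; exact: normr_ge0.
- by move=> k; apply: mulr_ge0 => //; apply: exp_coeff_ge0; rewrite mulr_ge0.
- move=> k; rewrite /coef /=.
  rewrite !normrM normfV normr_nat normrX.
  have -> : ((\sum_l `|B i l|) *: exp_coeff (K * `|t|)) k =
    k`!%:R^-1 * ((\sum_l `|B i l|) * K ^+ k) * `|t| ^+ k.
    by rewrite /exp_coeff fctE /GRing.scale/= exprMn; ring.
  rewrite ler_wpM2r ?exprn_ge0// ler_wpM2l ?invr_ge0//.
  rewrite mxE (le_trans (ler_norm_sum _ _ _))// mulr_suml.
  by apply: ler_sum => l _; rewrite normrM ler_wpM2l.
exact/is_cvg_seriesZ/is_cvg_series_exp_coeff.
Qed.

Lemma exp_series_coef A t i j :
  (fun N => series (exp_term A ^~ t) N i j) = pseries (coef 1%:M A i j) t.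
Proof.
apply/funext => N; rewrite /series /pseries /= summxE.
apply: eq_bigr => k _; rewrite /exp_term /coef mul1mx exprZn !mxE.
by ring.
Qed.

Lemma cvg_expmx_series A t : series (exp_term A ^~ t) @ \oo --> expmx (t *: A).
Proof.
suff : cvg (series (exp_term A ^~ t) @ \oo) by [].
apply: (cvgP (\matrix_(i, j) limn (pseries (coef 1%:M A i j) t))).
apply: cvg_mx => i j; rewrite mxE.
have := exp_series_coef A t i j.
move=> ->; exact: cvg_pseries_coef.
Qed.

Lemma mulmx_expmxE B A t i j :
  (B *m expmx (t *: A)) i j = limn (pseries (coef B A i j) t).
Proof.
apply/esym/cvg_lim => //; rewrite mxE.
have -> : pseries (coef B A i j) t =
    (fun N => \sum_l B i l * series (exp_term A ^~ t) N l j).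
  apply/funext => N; rewrite /pseries /series /=.
  under [RHS]eq_bigr do rewrite summxE mulr_sumr.
  rewrite exchange_big /=; apply: eq_bigr => k _; rewrite /coef mxE.
  rewrite mulr_sumr mulr_suml; apply: eq_bigr => l _.
  by rewrite /exp_term exprZn !mxE; ring.
apply: cvg_big => [|l _]; first exact: add_continuous.
apply: cvgMl_tmp.
exact: (@continuous_cvg _ _ _ _ _ _ (fun M : 'M[R]_m.+1 => M l j) _
  (@coord_continuous _ _ _ _ _ _) (@cvg_expmx_series A t)).
Qed.

Global Instance is_derive_mulmx_expmx B A i j t :
  is_derive t 1 (fun s => (B *m expmx (s *: A)) i j)
    ((B *m A *m expmx (t *: A)) i j).
Proof.
(* The factor k + 1 produced by differentiation cancels against (k + 1)!, which leaves one extra [A]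
   next to [C]. *)
have dE C : pseries_diffs (coef C A i j) = coef (C *m A) A i j.
  apply/funext => k; rewrite /pseries_diffs /coef factS natrM invfM.
  by rewrite !mulrA mulfV ?pnatr_eq0// mul1r exprS -mulmxE mulmxA.
under eq_fun do rewrite mulmx_expmxE.
rewrite mulmx_expmxE -dE.
apply: (@pseries_snd_diffs _ _ (`|t| + 1)); rewrite ?dE;
  try exact: cvg_pseries_coef.
by rewrite [ltRHS]ger0_norm// ltrDl.
Qed.

Lemma expmx0 : expmx (0 : 'M[R]_m.+1) = 1%:M.
Proof.
apply: (@cvg_lim 'M[R]_m.+1) => //.
(* The partial sum at N = 0 is empty; from N = 1 on, only the term k = 0 survives. *)
apply: cvg_near_cst; near=> N.
have N0 : (0 < N)%N by near: N; exact: nbhs_infty_gt.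
rewrite /series /= big_ltn// big_nat_cond big1 => [|k /andP[/andP[k0 _] _]].
  by rewrite addr0 expr0 fact0 invr1 scale1r.
by rewrite expr0n gtn_eqF// scaler0.
Unshelve. all: by end_near. Qed.

Lemma expmx_tr A t : expmx (t *: A^T) = (expmx (t *: A))^T.
Proof.
have trX k : (A^T) ^+ k = (A ^+ k)^T.
  elim: k => [|k IHk]; first by rewrite !expr0 trmx1.
  by rewrite [LHS]exprS exprSr IHk -!mulmxE trmx_mul.
apply/matrixP => i j; rewrite mxE.
rewrite -[expmx (t *: A^T)]mul1mx -[expmx (t *: A)]mul1mx.
rewrite !mulmx_expmxE; congr (limn (pseries _ t)); apply/funext => k.
by rewrite /coef !mul1mx trX mxE.
Qed.

End MatrixExponential.

(** * Exponential decay of e^{tA} for Hurwitz A *)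

Section ExponentialDecay.
Context {R : realType}.

Definition exp_decay (g : R -> R) := exists C c : R,
  [/\ 0 <= C, 0 < c & forall t, 0 <= t -> g t <= C * expR (- c * t)].

Lemma is_derive_expRM (a t : R) :
  is_derive t 1 (fun x => expR (a * x)) (a * expR (a * t)).
Proof.
apply: (@is_derive_eq _ _ _ (expR \o (a *: id))).
by rewrite mulrC /GRing.scale/= mulr1.
Qed.

(** For a small rate e, F(t) = e^{et} g(t) + (K/e) e^{-et} is nonincreasing: the derivative -K
    e^{-et} of the last term absorbs the forcing [r]. Hence g(t) <= F(0) e^{-et}. *)
Lemma gronwall_exp_decay (g dg r : R -> R) (kappa : R) :
  0 < kappa ->
  (forall t, 0 <= g t) -> (forall t : R, is_derive t 1 g (dg t)) ->
  exp_decay r -> (forall t, 0 <= t -> dg t <= - kappa * g t + r t) ->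
  exp_decay g.
Proof.
move=> kappa0 g0 dgE [K [c [K0 c0 rK]]] dgr.
(* Then e <= kappa lets the damping absorb e g, and 2e <= c gives e^{et} r(t) <= K e^{-et}. *)
pose e : R := Num.min kappa c / 2.
have e0 : 0 < e by rewrite divr_gt0// lt_min kappa0 c0.
have ek : e <= kappa.
  have : Num.min kappa c <= kappa by rewrite ge_min lexx.
  by rewrite /e; move: e0; rewrite /e; lra.
have ec : e + e <= c.
  by rewrite /e -splitr ge_min lexx orbT.
pose F t := expR (e * t) * g t + (K / e) * expR (- e * t).
have dF (t : R) : is_derive t 1 F
    (expR (e * t) * (e * g t + dg t) - K * expR (- e * t)).
  have := is_deriveD (is_deriveM (is_derive_expRM e t) (dgE t))
    (is_deriveZ (K / e) (is_derive_expRM (- e) t)).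
  move=> h; apply: (is_derive_eq h); rewrite /GRing.scale/=.
  by field; rewrite gt_eqF.
have Fle t : 0 <= t -> F t <= F 0.
  move=> t0.
  apply: (@ler0_derive1_le_cc _ F 0 t); rewrite ?in_itv/= ?lexx ?t0//.
  - move=> x; rewrite in_itv/= => /andP[/ltW x0 xt].
    rewrite derive1E derive_val subr_le0.
    have /ler_wpM2l : e * g x + dg x <= K * expR (- c * x).
      have := dgr x x0; have := rK x x0.
      have := ler_wpM2r (g0 x) ek; lra.
    move=> /(_ _ (expR_ge0 (e * x))) /le_trans; apply.
    rewrite mulrCA ler_wpM2l// -expRD ler_expR.
    by have := ler_wpM2r x0 ec; lra.
  - apply: continuous_subspaceT => x.
    exact/differentiable_continuous/derivable1_diffP.
exists (F 0), e; split => // [|t t0].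
  by rewrite /F addr_ge0// mulr_ge0 ?expR_ge0// divr_ge0// ltW.
rewrite -(ler_pM2l (expR_gt0 (e * t))) mulrCA -expRD mulNr subrr expR0 mulr1.
apply: le_trans (Fle t t0).
by rewrite /F lerDl mulr_ge0 ?expR_ge0// divr_ge0// ltW.
Qed.

Section Matrix.
Context {m : nat}.
Variable A : 'M[R]_m.+1.

Local Notation Ac := (map_mx (real_complex R) A).
Local Notation re B := (map_mx (@complex.Re R) B).
Local Notation im B := (map_mx (@complex.Im R) B).

Lemma Re_mulmx_real (B : 'M[R[i]]_m.+1) : re (B *m Ac) = re B *m A.
Proof.
apply/matrixP => k l; rewrite !mxE.
rewrite (big_morph (@complex.Re R) (id1 := 0) (op1 := +%R))//; last first.
  by move=> [? ?] [? ?].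
apply: eq_bigr => h _; rewrite !mxE.
by case: (B k h) => a b /=; rewrite mulr0 subr0.
Qed.

Lemma Im_mulmx_real (B : 'M[R[i]]_m.+1) : im (B *m Ac) = im B *m A.
Proof.
apply/matrixP => k l; rewrite !mxE.
rewrite (big_morph (@complex.Im R) (id1 := 0) (op1 := +%R))//; last first.
  by move=> [? ?] [? ?].
apply: eq_bigr => h _; rewrite !mxE.
by case: (B k h) => a b /=; rewrite mulr0 add0r.
Qed.

(** The sum of squares is the squared modulus of an entry of B e^{tA}. Splitting [B] into real and
    imaginary parts handles complex roots with the real exponential alone. *)
Lemma exp_decay_roots (rs : seq R[i]) (B : 'M[R[i]]_m.+1) i j :
  (forall z, z \in rs -> complex.Re z < 0) ->
  B * horner_mx Ac (\prod_(z <- rs) ('X - z%:P)) = 0 ->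
  exp_decay (fun t => (re B *m expmx (t *: A)) i j ^+ 2 +
                      (im B *m expmx (t *: A)) i j ^+ 2).
Proof.
elim: rs B => [|z rs IHrs] B rsP.
  rewrite big_nil rmorph1 mulr1 => ->.
  exists 0, 1; split => // t _.
  have -> : re (0 : 'M[R[i]]_m.+1) = 0 by apply/matrixP => k l; rewrite !mxE.
  have -> : im (0 : 'M[R[i]]_m.+1) = 0 by apply/matrixP => k l; rewrite !mxE.
  by rewrite !mul0mx mxE expr0n /= addr0 mul0r.
rewrite big_cons rmorphM /= rmorphB /= horner_mx_X horner_mx_C mulrA.
set B' := B * _; move=> B'0.
have {}IHrs := IHrs B' (fun w wrs => rsP w (mem_behead (s := z :: rs) wrs)) B'0.
have x0 : complex.Re z < 0 by apply: rsP; rewrite mem_head.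
pose x := complex.Re z; pose y := complex.Im z.
pose p t := (re B *m expmx (t *: A)) i j.
pose q t := (im B *m expmx (t *: A)) i j.
pose p' t := (re B' *m expmx (t *: A)) i j.
pose q' t := (im B' *m expmx (t *: A)) i j.
(* Real and imaginary parts of B A = B' + z B, with z = x + iy. *)
have reA : re B *m A = re B' + x *: re B - y *: im B.
  rewrite -Re_mulmx_real; apply/matrixP => k l.
  rewrite /B' mulrBr -mulmxE mul_mx_scalar !mxE.
  case: (\sum_h _) => a b; rewrite /x /y.
  by case: (B k l) (z) => ? ? [? ?] /=; ring.
have imA : im B *m A = im B' + x *: im B + y *: re B.
  rewrite -Im_mulmx_real; apply/matrixP => k l.
  rewrite /B' mulrBr -mulmxE mul_mx_scalar !mxE.
  case: (\sum_h _) => a b; rewrite /x /y.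
  by case: (B k l) (z) => ? ? [? ?] /=; ring.
have dp (t : R) : is_derive t 1 p (p' t + x * p t - y * q t).
  apply: (is_derive_eq (is_derive_mulmx_expmx (re B) A i j t)).
  by rewrite /p' /p /q reA !mulmxDl mulNmx -!scalemxAl !mxE.
have dq (t : R) : is_derive t 1 q (q' t + x * q t + y * p t).
  apply: (is_derive_eq (is_derive_mulmx_expmx (im B) A i j t)).
  by rewrite /q' /p /q imA !mulmxDl -!scalemxAl !mxE.
(* The rotation terms in y cancel here, so only the real part of z acts on the squared modulus. *)
have dg (t : R) : is_derive t 1 (fun s => p s ^+ 2 + q s ^+ 2)
    (2 * p t * (p' t + x * p t - y * q t) +
     2 * q t * (q' t + x * q t + y * p t)).
  have := is_deriveD (is_deriveX 2 (dp t)) (is_deriveX 2 (dq t)).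
  by move=> h; apply: (is_derive_eq h); rewrite /GRing.scale/= !expr1.
have xN : 0 < - x by rewrite oppr_gt0.
apply: (gronwall_exp_decay xN _ dg
  (r := fun t => (- x)^-1 * (p' t ^+ 2 + q' t ^+ 2))) => [t||t t0].
- by rewrite addr_ge0 ?sqr_ge0.
- case: IHrs => K [c [K0 c0 Kc]]; exists ((- x)^-1 * K), c; split => //.
    by rewrite mulr_ge0// invr_ge0 ltW.
  by move=> t t0; rewrite -mulrA ler_wpM2l ?Kc// invr_ge0 ltW.
(* Young's inequality with weight -x spends half of the damping 2x on the cross terms 2 p p' and 2 q
   q'; the remaining rate -x feeds Gronwall. *)
have young (a b : R) : 2 * a * b <= - x * a ^+ 2 + (- x)^-1 * b ^+ 2.
  rewrite -subr_ge0.
  have -> : - x * a ^+ 2 + (- x)^-1 * b ^+ 2 - 2 * a * b =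
      (- x)^-1 * (- x * a - b) ^+ 2 by field; rewrite lt_eqF.
  by rewrite mulr_ge0 ?sqr_ge0// invr_ge0 ltW.
have := young (p t) (p' t); have := young (q t) (q' t).
lra.
Qed.

Lemma expmx_decay i j : hurwitz A ->
  exp_decay (fun t => expmx (t *: A) i j ^+ 2).
Proof.
move=> hA.
have [rs chE] := closed_field_poly_normal (char_poly Ac).
rewrite (monicP (char_poly_monic _)) scale1r in chE.
have rsP z : z \in rs -> complex.Re z < 0.
  by move=> zrs; apply: hA; rewrite eigenvalue_root_char chE root_prod_XsubC.
have := @exp_decay_roots rs 1 i j rsP.
rewrite -chE Cayley_Hamilton mulr0 => /(_ erefl) [C [c [C0 c0 Cc]]].
exists C, c; split => // t t0; apply: le_trans (Cc t t0).
have -> : re (1 : 'M[R[i]]_m.+1) = 1%:M.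
  by apply/matrixP => k l; rewrite !mxE; case: eqP.
by rewrite mul1mx lerDl sqr_ge0.
Qed.

End Matrix.
End ExponentialDecay.

(** * The Lyapunov integral operator: integrability, linearity, positivity *)

Section LyapunovIntegral.
Context {R : realType}.
Local Notation leb := (@lebesgue_measure R).
Local Notation halfline := (`[(0 : R), +oo[%classic).

Lemma Rintegral_lincomb d (T : measurableType d)
    (mu : {measure set T -> \bar R}) (D : set T)
    (I : Type) (s : seq I) (Q : pred I) (c : I -> R)
    (f : I -> T -> R) : measurable D ->
  (forall i, mu.-integrable D (EFin \o f i)) ->
  mu.-integrable D (EFin \o (fun t => \sum_(i <- s | Q i) c i * f i t)) /\
  \int[mu]_(t in D) (\sum_(i <- s | Q i) c i * f i t) =
  \sum_(i <- s | Q i) c i * \int[mu]_(t in D) f i t.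
Proof.
move=> mD fi.
have cfi i : mu.-integrable D (EFin \o (fun t => c i * f i t)).
  by have := integrableZl mD (c i) (fi i); under eq_fun do rewrite -EFinM.
elim: s => [|i s [IHi IHs]].
  have -> : (fun t => \sum_(i <- [::] | Q i) c i * f i t) = cst 0.
    by apply/funext => t; rewrite big_nil.
  by rewrite big_nil Rintegral_cst// mul0r; split => //; exact: integrable0.
have e : (fun t => \sum_(i <- i :: s | Q i) c i * f i t) =
   if Q i then (fun t => c i * f i t + \sum_(i <- s | Q i) c i * f i t)
   else (fun t => \sum_(i <- s | Q i) c i * f i t).
  by apply/funext => t; rewrite big_cons; case: ifP.
rewrite e big_cons; case: ifP => // Qi; split.
  by have := integrableD mD (cfi i) IHi; under eq_fun do rewrite -EFinD.
by rewrite RintegralD// RintegralZl// IHs.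
Qed.

Lemma integrable_exp_decay (f g : R -> R) : measurable_fun setT f ->
  (forall t, 0 <= t -> `|f t| <= g t) -> exp_decay g ->
  leb.-integrable halfline (EFin \o f).
Proof.
move=> mf fg [C [c [C0 c0 Cc]]].
have pdfi : leb.-integrable halfline (EFin \o exponential_pdf c).
  exact: integrableS (integrable_exponential_pdf c0).
have mH : measurable (halfline : set (measurableTypeR R)).
  exact: measurable_itv.
(* On the half-line, C e^{-ct} is C/c times the exponential density of parameter c. *)
apply: (le_integrable mH _ _ (integrableZl mH (C / c) pdfi)).
  by apply/measurable_EFinP; exact: measurable_funTS.
move=> t; rewrite /= in_itv/= andbT => t0.
rewrite lee_fin; apply: le_trans (ler_norm _).
apply: le_trans (fg t t0) (le_trans (Cc t t0) _).
rewrite /exponential_pdf patchE mem_set/=; last by rewrite in_itv/= t0.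
by rewrite mulrA divfK// gt_eqF.
Qed.

(** By continuity f >= f(0)/2 on a ball of radius e around 0; the closed interval [0, e/2] lies
    inside it and already contributes a positive amount. *)
Lemma Rintegral_halfline_gt0 (f : R -> R) : continuous f ->
  leb.-integrable halfline (EFin \o f) ->
  (forall t, 0 <= f t) -> 0 < f 0 -> 0 < \int[leb]_(t in halfline) f t.
Proof.
move=> cf fi f0 f00.
have f02 : 0 < f 0 / 2 by rewrite divr_gt0.
have /cvgrPdist_le/(_ _ f02) := cf 0.
rewrite near_simpl => /nbhs_ballP[e /= e0 eb].
have e2 : 0 < e / 2 by rewrite divr_gt0.
have mf (D : set (measurableTypeR R)) : measurable_fun D (EFin \o f).
  apply/measurable_EFinP; apply: measurable_funTS.
  exact: continuous_measurable_fun.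
have mH : measurable (halfline : set (measurableTypeR R)).
  exact: measurable_itv.
have mI : measurable (`[0, e / 2]%classic : set (measurableTypeR R)).
  exact: measurable_itv.
rewrite -lte_fin /Rintegral fineK; last exact: (integrable_fin_num mH fi).
have I0 : (0%:E < \int[leb]_(t in `[0%R, (e / 2)%R]) (f 0 / 2)%:E)%E.
  rewrite integral_cst//= lebesgue_measure_itv/= lte_fin e2 -EFinB subr0.
  by rewrite -EFinM lte_fin mulr_gt0.
apply: (lt_le_trans I0).
apply: (@le_trans _ _ (\int[leb]_(t in `[0%R, (e / 2)%R]) (f t)%:E)%E).
  apply: ge0_le_integral => //.
  - by move=> t _; rewrite lee_fin ltW.
  - move=> t; rewrite /= in_itv/= => /andP[t0 te].
    have /eb : ball 0 e t.
      by rewrite /ball/= sub0r normrN ger0_norm//; lra.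
    by rewrite lee_fin ler_norml => /andP[_]; lra.
apply: ge0_subset_integral => //.
- by move=> t _; rewrite lee_fin.
- by move=> t; rewrite /= !in_itv/= andbT => /andP[].
Qed.

(** Displays the form as linear in the entries of [M], the shape in which [Rintegral_lincomb] moves
    it through an integral. *)
Lemma quad_formE m (M : 'M[R]_m) (x : 'cV[R]_m) :
  (x^T *m M *m x) 0 0 =
  \sum_(p : 'I_m * 'I_m) (x p.1 0 * x p.2 0) * M p.1 p.2.
Proof.
rewrite mxE; under eq_bigr do rewrite !mxE mulr_suml.
rewrite exchange_big pair_big/=; apply: eq_bigr => -[k l] _ /=.
by rewrite !mxE; ring.
Qed.

Section Matrix.
Context {m : nat}.
Variable A : 'M[R]_m.+1.
Hypothesis hA : hurwitz A.

Local Notation E t := (expmx (t *: A)).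

(** For Hurwitz [A] this is the solution X of the Lyapunov equation A X + X A^T = -U. By conversion,
    [V_theta] is its value at [U_theta] for the drift matrix. *)
Definition lyapunov (U : 'M[R]_m.+1) : 'M[R]_m.+1 :=
  \matrix_(i, j) \int[leb]_(t in halfline) ((E t *m U *m expmx (t *: A^T)) i j).

Lemma continuous_expmx i j : continuous (fun t : R => E t i j).
Proof.
move=> t; apply/differentiable_continuous/derivable1_diffP.
have := is_derive_mulmx_expmx 1%:M A i j t.
by under eq_fun do rewrite mul1mx; case.
Qed.

(** Since 2|ab| <= a^2 + b^2, the decay of squared entries suffices, at the slower of the two
    rates. *)
Lemma integrable_expmx_prod (p : ('I_m.+1 * 'I_m.+1) * ('I_m.+1 * 'I_m.+1)) :
  leb.-integrable halfline
    (EFin \o (fun t => E t p.1.1 p.1.2 * E t p.2.1 p.2.2)).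
Proof.
apply: (@integrable_exp_decay _
  (fun t => 2^-1 * (E t p.1.1 p.1.2 ^+ 2 + E t p.2.1 p.2.2 ^+ 2))).
- apply: measurable_funM; apply: continuous_measurable_fun;
    exact: continuous_expmx.
- move=> t _; rewrite normrM.
  have := sqr_ge0 (`|E t p.1.1 p.1.2| - `|E t p.2.1 p.2.2|).
  by rewrite sqrrB !real_normK ?num_real//; lra.
have [C [c [C0 c0 Cc]]] := expmx_decay p.1.1 p.1.2 hA.
have [C' [c' [C0' c0' Cc']]] := expmx_decay p.2.1 p.2.2 hA.
exists (2^-1 * (C + C')), (Num.min c c'); split.
- by rewrite mulr_ge0 ?addr_ge0.
- by rewrite lt_min c0.
- move=> t t0; rewrite -mulrA ler_wpM2l// mulrDl lerD//.
    apply: le_trans (Cc t t0) _; rewrite ler_wpM2l// ler_expR ler_wpM2r// lerN2.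
    by rewrite ge_min lexx.
  apply: le_trans (Cc' t t0) _; rewrite ler_wpM2l// ler_expR ler_wpM2r// lerN2.
  by rewrite ge_min lexx orbT.
Qed.

Lemma lyapunov_integrandE U i j t :
  (E t *m U *m expmx (t *: A^T)) i j =
  \sum_(p : 'I_m.+1 * 'I_m.+1) U p.1 p.2 * (E t i p.1 * E t j p.2).
Proof.
rewrite expmx_tr mxE; under eq_bigr do rewrite !mxE mulr_suml.
rewrite exchange_big pair_big/=; apply: eq_bigr => -[k l] _ /=; ring.
Qed.

Lemma lyapunov_integrable U i j : leb.-integrable halfline
  (EFin \o (fun t => (E t *m U *m expmx (t *: A^T)) i j)).
Proof.
rewrite (funext (lyapunov_integrandE U i j)).
have [] // := @Rintegral_lincomb _ _ leb halfline _
  (index_enum ('I_m.+1 * 'I_m.+1)%type) xpredT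
  (fun p => U p.1 p.2) (fun p t => E t i p.1 * E t j p.2).
by move=> p; exact: (integrable_expmx_prod ((i, p.1), (j, p.2))).
Qed.

Lemma lyapunov_lincomb (I : finType) (Q : pred I) (c : I -> R)
    (U : I -> 'M[R]_m.+1) :
  lyapunov (\sum_(k | Q k) c k *: U k) = \sum_(k | Q k) c k *: lyapunov (U k).
Proof.
apply/matrixP => i j; rewrite summxE !mxE.
under [RHS]eq_bigr do rewrite !mxE.
have [] // := @Rintegral_lincomb _ _ leb halfline _ (index_enum I) Q c
  (fun k t => (E t *m U k *m expmx (t *: A^T)) i j).
  by move=> k; exact: lyapunov_integrable.
move=> _ <-; apply: eq_Rintegral => t _ /=.
rewrite mulmx_sumr mulmx_suml summxE; apply: eq_bigr => k _.
by rewrite -scalemxAr -scalemxAl mxE.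
Qed.

Lemma lyapunov_integrand_psd U t (x : 'cV[R]_m.+1) : psd U ->
  0 <= (x^T *m (E t *m U *m expmx (t *: A^T)) *m x) 0 0.
Proof.
(* Congruence: the form of the integrand at x is the form of [U] at e^{tA^T} x. *)
move=> [_ /(_ ((E t)^T *m x))].
by rewrite expmx_tr trmx_mul trmxK !mulmxA.
Qed.

Lemma lyapunov_quad U (x : 'cV[R]_m.+1) :
  leb.-integrable halfline
    (EFin \o (fun t => (x^T *m (E t *m U *m expmx (t *: A^T)) *m x) 0 0)) /\
  (x^T *m lyapunov U *m x) 0 0 =
  \int[leb]_(t in halfline) (x^T *m (E t *m U *m expmx (t *: A^T)) *m x) 0 0.
Proof.
rewrite quad_formE; under eq_bigr do rewrite mxE.
rewrite (funext (fun t => quad_formE (E t *m U *m expmx (t *: A^T)) x)).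
have [] // := @Rintegral_lincomb _ _ leb halfline _
  (index_enum ('I_m.+1 * 'I_m.+1)%type) xpredT
  (fun p => x p.1 0 * x p.2 0)
  (fun p t => (E t *m U *m expmx (t *: A^T)) p.1 p.2).
by move=> k; exact: lyapunov_integrable.
Qed.

Lemma lyapunov_psd U : psd U -> psd (lyapunov U).
Proof.
move=> Upsd; have [Usym _] := Upsd; split.
  apply/matrixP => i j; rewrite !mxE; apply: eq_Rintegral => t _.
  have symM : (E t *m U *m (E t)^T)^T = E t *m U *m (E t)^T.
    by rewrite !trmx_mul trmxK Usym mulmxA.
  by rewrite expmx_tr -[in LHS]symM mxE.
move=> x; have [_ ->] := lyapunov_quad U x.
by apply: Rintegral_ge0 => t _; exact: lyapunov_integrand_psd.
Qed.

Lemma lyapunov_pos U (x : 'cV[R]_m.+1) : psd U ->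
  0 < (x^T *m U *m x) 0 0 -> 0 < (x^T *m lyapunov U *m x) 0 0.
Proof.
move=> Upsd xUx; have [qi ->] := lyapunov_quad U x.
apply: Rintegral_halfline_gt0 => // [|t|].
- rewrite (funext (fun t => quad_formE (E t *m U *m expmx (t *: A^T)) x)).
  apply: continuous_big => [|p _ t]; first exact: add_continuous.
  apply: cvgMl_tmp; rewrite lyapunov_integrandE.
  rewrite (funext (lyapunov_integrandE U p.1 p.2)).
  apply: cvg_big => [|q _]; first exact: add_continuous.
  by apply: cvgMl_tmp; apply: cvgM; exact: continuous_expmx.
- exact: lyapunov_integrand_psd.
(* At t = 0 both exponentials are 1 and the integrand is x^T U x. *)
- by rewrite !scale0r expmx0 mul1mx mulmx1.
Qed.

End Matrix.
End LyapunovIntegral.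

(** * Weighted sums of Gram matrices h^T h *)

Section GramSums.
Context {R : realType} {m : nat} {I : finType}.
Variables (Q : pred I) (c : I -> R) (h : I -> 'rV[R]_m).

Local Notation gram := (\sum_(i | Q i) c i *: ((h i)^T *m h i)).

Lemma gram_sum_quad (x : 'cV[R]_m) :
  (x^T *m gram *m x) 0 0 = \sum_(i | Q i) c i * (h i *m x) 0 0 ^+ 2.
Proof.
rewrite mulmx_sumr mulmx_suml summxE; apply: eq_bigr => i _.
rewrite -scalemxAr -scalemxAl mxE; congr (_ * _).
rewrite mulmxA -trmx_mul -mulmxA mxE big_ord1 [_^T _ _]mxE.
by rewrite expr2.
Qed.

Lemma gram_sum_psd : (forall i, Q i -> 0 <= c i) -> psd gram.
Proof.
move=> c0; split=> [|x].
  rewrite [LHS](linear_sum (@trmx R m m)); apply: eq_bigr => i _.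
  by rewrite linearZ/= trmx_mul trmxK.
rewrite gram_sum_quad; apply: sumr_ge0 => i Qi.
by rewrite mulr_ge0 ?sqr_ge0 ?c0.
Qed.

(** At x = h_k^T the k-th term is c_k times the square of the squared Euclidean norm of h_k; all
    other terms are nonnegative. *)
Lemma gram_sum_pos k : (forall i, Q i -> 0 < c i) -> Q k -> h k != 0 ->
  0 < (h k *m gram *m (h k)^T) 0 0.
Proof.
move=> c0 Qk hk0; rewrite -{1}[h k]trmxK gram_sum_quad (bigD1 k)//=.
apply: ltr_wpDr.
  by apply: sumr_ge0 => i /andP[Qi _]; rewrite mulr_ge0 ?sqr_ge0// ltW ?c0.
rewrite mulr_gt0 ?c0// exprn_gt0// lt_neqAle eq_sym.
have normE : (h k *m (h k)^T) 0 0 = \sum_j h k 0 j ^+ 2.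
  by rewrite mxE; apply: eq_bigr => j _; rewrite mxE expr2.
rewrite normE sumr_ge0 ?andbT => [|j _]; last exact: sqr_ge0.
apply: contraNneq hk0 => /eqP; rewrite psumr_eq0 => [|j _]; last exact: sqr_ge0.
move=> /allP hk; apply/eqP/rowP => j; rewrite mxE.
by apply/eqP; rewrite -sqrf_eq0; apply: hk; rewrite mem_index_enum.
Qed.

End GramSums.

(** * The scalar weight of an eigenvalue: monotonicity and decay in alpha *)

Section Coefficient.
Context {R : realType}.
Implicit Types lambda alpha : R.

Definition srrw_coef alpha lambda : R :=
  ((alpha * (1 + lambda) + 1) ^+ 2)^-1 * ((1 + lambda) / (1 - lambda)).

Lemma srrw_coef_decreasing lambda alpha1 alpha2 : -1 < lambda -> lambda < 1 ->
  0 <= alpha1 -> alpha1 < alpha2 ->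
  srrw_coef alpha2 lambda < srrw_coef alpha1 lambda.
Proof.
move=> l1 l2 a1 a12.
have l0 : 0 < 1 + lambda by lra.
rewrite /srrw_coef ltr_pM2r; last by rewrite divr_gt0//; lra.
have p1 : 0 < alpha1 * (1 + lambda) + 1 by rewrite ltr_wpDl// mulr_ge0// ltW.
have p12 : alpha1 * (1 + lambda) + 1 < alpha2 * (1 + lambda) + 1.
  by rewrite ltrD2r ltr_pM2r.
have p2 := lt_trans p1 p12.
by rewrite ltf_pV2 ?posrE ?exprn_gt0// ltrXn2r// ?qualifE/= ltW.
Qed.

Lemma srrw_coef_bound lambda alpha : -1 < lambda -> lambda < 1 -> 0 < alpha ->
  `|srrw_coef alpha lambda| <=
  ((1 + lambda) * (1 - lambda))^-1 * (alpha ^+ 2)^-1.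
Proof.
move=> l1 l2 a0.
have l0 : 0 < 1 + lambda by lra.
have l3 : 0 < 1 - lambda by lra.
have al0 : 0 < alpha * (1 + lambda) by rewrite mulr_gt0.
(* The majorant is the same weight without the + 1 inside the square. *)
have -> : ((1 + lambda) * (1 - lambda))^-1 * (alpha ^+ 2)^-1 =
    ((alpha * (1 + lambda)) ^+ 2)^-1 * ((1 + lambda) / (1 - lambda)).
  by field; rewrite !gt_eqF.
rewrite ger0_norm; last first.
  by rewrite mulr_ge0 ?invr_ge0 ?sqr_ge0// divr_ge0 ?ltW.
rewrite ler_wpM2r ?divr_ge0 ?(ltW l0) ?(ltW l3)//.
rewrite lef_pV2 ?posrE ?exprn_gt0//; last by rewrite addr_gt0.
by rewrite lerXn2r// ?qualifE/= ?lerDl ?addr_ge0 ?ltW.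
Qed.

End Coefficient.

(** * The left eigenvectors form a basis *)

Section Nondegenerate.
Context {R : realType} {n : nat}.

(** Biorthonormality makes the matrix with rows [u i] invertible, its inverse having the columns
    [v j]. *)
Lemma spectral_data_left_inj (P : 'M[R]_n.+1) mu lam u v p
    (M : 'M[R]_(n.+1, p)) :
  spectral_data P mu lam u v -> (forall i, u i *m M = 0) -> M = 0.
Proof.
move=> spec uM.
pose Um : 'M[R]_n.+1 := \matrix_i u i.
pose Vm : 'M[R]_n.+1 := \matrix_(i, j) v j i 0.
have UV : Um *m Vm = 1%:M.
  apply/matrixP => i j; rewrite [RHS]mxE -(spec_orth spec) !mxE.
  by apply: eq_bigr => k _; rewrite !mxE.
have UM : Um *m M = 0.
  by apply/row_matrixP => i; rewrite row_mul rowK uM row0.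
by rewrite -[M]mul1mx -(mulmx1C UV) -mulmxA UM mulmx0.
Qed.

End Nondegenerate.

(** * Loewner order, limit and rate for the asymptotic covariance *)

Theorem proposition3p4 (R : realType) (n d : nat)
  (P : 'M[R]_n.+1) (mu : 'rV[R]_n.+1)
  (lam : 'I_n.+1 -> R) (u : 'I_n.+1 -> 'rV[R]_n.+1) (v : 'I_n.+1 -> 'cV[R]_n.+1)
  (H : 'rV[R]_d.+1 -> 'I_n.+1 -> 'rV[R]_d.+1) (a b : R)
  (thetas : 'rV[R]_d.+1)
  (P_ergodic : ergodic P)
  (mu_int : simplex_int mu)
  (mu_stationary : mu *m P = mu)
  (P_reversible : reversible P mu)
  (spec : spectral_data P mu lam u v)
  (a_gt : 2^-1 < a) (a_lt_b : a < b) (b_le1 : b <= 1)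
  (opt : optimization_data mu H b)
  (stable : srrw_stable P mu H a b)
  (thetas_Theta : Theta_set mu H b thetas) :
  let V := V_theta mu H b lam u thetas in
  ((exists i, H thetas i <> 0) ->
   forall alpha1 alpha2 : R, 0 < alpha1 -> alpha1 < alpha2 ->
     loewner_lt (V alpha2) (V alpha1) /\ loewner_lt (V alpha1) (V 0)) /\
  (V alpha @[alpha --> +oo] --> (0 : 'M[R]_d.+1)) /\
  (exists2 C : R, 0 < C &
     \forall alpha \near +oo, `|V alpha| <= C * `|(alpha ^+ 2)^-1|).
Proof.
move=> V.
have [h0 _ hA] := thetas_Theta.
set A := drift_mx mu H b thetas in hA.
pose h i : 'rV[R]_d.+1 := u i *m H_mx H thetas.
pose G i := (h i)^T *m h i.
have lam_gt i : -1 < lam i.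
  by apply: lt_le_trans (spec_gt spec) _; exact: (spec_le spec).
have lam_lt i : i != ord_max -> lam i < 1 by exact: (spec_lt1 spec).
have UE alpha : U_theta H lam u thetas alpha =
    \sum_(i | i != ord_max) srrw_coef alpha (lam i) *: G i.
  by apply: eq_bigr => i _; rewrite /G /h trmx_mul !mulmxA.
have VE alpha : V alpha =
    \sum_(i | i != ord_max) srrw_coef alpha (lam i) *: lyapunov A (G i).
  by rewrite -(lyapunov_lincomb hA) -UE.
have [C C0 VC] : exists2 C : R, 0 < C &
    forall alpha, 0 < alpha -> `|V alpha| <= C * (alpha ^+ 2)^-1.
  pose C0 := \sum_(i | i != ord_max)
    ((1 + lam i) * (1 - lam i))^-1 * `|lyapunov A (G i)|.
  have C0_ge0 : 0 <= C0.
    apply: sumr_ge0 => i iN; rewrite mulr_ge0// invr_ge0 mulr_ge0//.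
      by have := lam_gt i; lra.
    by have := lam_lt i iN; lra.
  (* The + 1 keeps the constant strictly positive even when [C0] is 0. *)
  exists (C0 + 1) => [|alpha alpha0]; first by rewrite ltr_wpDl.
  apply: (@le_trans _ _ (C0 * (alpha ^+ 2)^-1)); last first.
    by rewrite ler_wpM2r ?invr_ge0 ?sqr_ge0// lerDl.
  rewrite VE (le_trans (ler_norm_sum _ _ _))// mulr_suml.
  apply: ler_sum => i iN.
  rewrite normrZ mulrAC ler_wpM2r//.
  by apply: srrw_coef_bound => //; exact: lam_lt.
have nearC : \forall alpha \near +oo, `|V alpha| <= C * (alpha ^+ 2)^-1.
  near=> alpha; apply: VC; near: alpha; exact: nbhs_pinfty_gt.
split; last first.
  split; last first.
    exists C => //; apply: filterS nearC => alpha /le_trans; apply.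
    by rewrite ler_wpM2l ?ler_norm// ltW.
  apply/cvgr0Pnorm_le => e e0; near=> alpha.
  (* Above both thresholds, C <= e alpha <= e alpha^2. *)
  have alpha1 : 1 < alpha by near: alpha; exact: nbhs_pinfty_gt.
  have alphaC : C / e < alpha by near: alpha; exact/nbhs_pinfty_gt/num_real.
  have alpha_gt0 : 0 < alpha by exact: lt_trans alpha1.
  apply: le_trans (VC alpha alpha_gt0) _.
  rewrite ler_pdivrMr ?exprn_gt0// -ler_pdivrMl// mulrC.
  by rewrite (le_trans (ltW alphaC))// expr2 ler_peMr // ltW.
(* If [H thetas] vanished at every state, V would be identically 0 and no strict order could hold;
   the premise excludes this. *)
move=> [i0 Hi0] alpha1 alpha2 alpha1_gt0 alpha12.
have [k kN hk] : exists2 k, k != ord_max & h k != 0.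
  apply: contrapT => noneg.
  apply: Hi0.
  have hz i : h i = 0.
    have [->|iN] := eqVneq i ord_max.
      rewrite /h (spec_uN spec) -h0; apply/rowP => j.
      by rewrite !mxE summxE; apply: eq_bigr => l _; rewrite !mxE.
    by apply/eqP; apply: contrapT => /negP hi; apply: noneg; exists i.
  have HM : H_mx H thetas = 0 := spectral_data_left_inj spec hz.
  by apply/rowP => j; have /matrixP/(_ i0 j) := HM; rewrite !mxE.
(* Allowing b1 = 0 covers the comparison with [V 0] as well. *)
have decr b1 b2 : 0 <= b1 -> b1 < b2 -> loewner_lt (V b2) (V b1).
  move=> b10 b12.
  pose c i := srrw_coef b1 (lam i) - srrw_coef b2 (lam i).
  have c0 i : i != ord_max -> 0 < c i.
    by move=> iN; rewrite subr_gt0 srrw_coef_decreasing// lam_lt.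
  have VB : V b1 - V b2 = lyapunov A (\sum_(i | i != ord_max) c i *: G i).
    rewrite (lyapunov_lincomb hA) !VE -sumrB; apply: eq_bigr => i _.
    by rewrite -scalerBl.
  have Gpsd : psd (\sum_(i | i != ord_max) c i *: G i).
    by apply: gram_sum_psd => i /c0/ltW.
  split; first by rewrite VB; exact: lyapunov_psd.
  (* Equality would make the form of V b1 - V b2 vanish at h_k^T, where it is positive. *)
  move=> V12; have := gram_sum_pos c0 kN hk.
  rewrite -{1}[h k]trmxK => /(lyapunov_pos hA Gpsd).
  by rewrite -VB V12 subrr mulmx0 mul0mx mxE ltxx.
by split; apply: decr => //; exact: ltW.
Unshelve. all: by end_near.
Qed.
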